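(* Let $Y\in\mathbb{H}^{n\times n}$. Then $$r^\vee(Y)=\min\Big\{\operatorname{Tr}W:\ W\in\mathbb{H}^{n\times n},\ \begin{bmatrix}W&Y\\ Y^*&W\end{bmatrix}\in\mathrm{H}_{2n,+}(\mathbb{H})\Big\}.$$
   Context: $\mathbb{H}$ is the skew-field of quaternions, with $|q|$ the modulus and $\Re q$ the real part; $A^*$ is the conjugate transpose of a quaternionic matrix and $\operatorname{Tr}$ the sum of diagonal entries (real for selfadjoint matrices). $\mathrm{H}_{N,+}(\mathbb{H})$ is the cone of positive semidefinite matrices in $\mathbb{H}^{N\times N}$: those $Z$ with $Z^*=Z$ and $\mathbf{x}^*Z\mathbf{x}\ge0$ for all $\mathbf{x}\in\mathbb{H}^N$ (so any feasible $W$ is selfadjoint). For $A\in\mathbb{H}^{n\times n}$ the numerical radius is $r(A)=\max\{|\mathbf{x}^*A\mathbf{x}|:\mathbf{x}\in\mathbb{H}^n,\ \mathbf{x}^*\mathbf{x}=1\}$, and its dual norm is $r^\vee(C)=\max\{\Re\operatorname{Tr}(A^*C):A\in\mathbb{H}^{n\times n},\ r(A)\le1\}$ for $C\in\mathbb{H}^{n\times n}$. *)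

(* Defs.v *)
From HB Require Import structures.
From mathcomp Require Import all_boot all_order all_algebra.
From mathcomp Require Import ring.
From mathcomp Require Import boolp classical_sets reals.
Set Implicit Arguments.
Unset Strict Implicit.
Unset Printing Implicit Defensive.
Import Order.TTheory GRing.Theory Num.Theory.
Local Open Scope ring_scope.
Local Open Scope classical_set_scope.

(* [Quat a b c d] is a + b i + c j + d k. *)
Record quaternion (R : Type) : Type :=
  Quat { qre : R; qim1 : R; qim2 : R; qim3 : R }.

Definition tuple_of_quat (R : Type) (q : quaternion R) : R * R * R * R :=
  (qre q, qim1 q, qim2 q, qim3 q).
Definition quat_of_tuple (R : Type) (t : R * R * R * R) : quaternion R :=
  let: (a, b, c, d) := t in Quat a b c d.
Lemma tuple_of_quatK (R : Type) :
  cancel (@tuple_of_quat R) (@quat_of_tuple R).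
Proof. by case. Qed.

HB.instance Definition _ (R : choiceType) :=
  Choice.copy (quaternion R) (can_type (@tuple_of_quatK R)).

Section QuaternionZmodule.
Variable R : zmodType.
Implicit Types p q : quaternion R.

Definition quat_add p q : quaternion R :=
  Quat (qre p + qre q) (qim1 p + qim1 q) (qim2 p + qim2 q) (qim3 p + qim3 q).
Definition quat_opp p : quaternion R :=
  Quat (- qre p) (- qim1 p) (- qim2 p) (- qim3 p).

(* The quaternion a + 0 i + 0 j + 0 k. *)
Definition qreal (a : R) : quaternion R := Quat a 0 0 0.

Definition qconj q : quaternion R :=
  Quat (qre q) (- qim1 q) (- qim2 q) (- qim3 q).

Lemma quat_addA : associative quat_add.
Proof. by move=> p q s; rewrite /quat_add /= !addrA. Qed.
Lemma quat_addC : commutative quat_add.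
Proof. by move=> [? ? ? ?] [? ? ? ?]; congr Quat; rewrite /= addrC. Qed.
Lemma quat_add0q : left_id (qreal 0) quat_add.
Proof. by move=> [? ? ? ?]; rewrite /quat_add /= !add0r. Qed.
Lemma quat_addNq : left_inverse (qreal 0) quat_opp quat_add.
Proof. by move=> [? ? ? ?]; rewrite /quat_add /= !addNr. Qed.

HB.instance Definition _ :=
  GRing.isZmodule.Build (quaternion R) quat_addA quat_addC quat_add0q quat_addNq.
End QuaternionZmodule.

Section QuaternionRing.
Variable R : comNzRingType.
Implicit Types p q : quaternion R.

Definition quat_mul p q : quaternion R :=
  let: Quat a b c d := p in
  let: Quat a' b' c' d' := q in
  Quat (a * a' - b * b' - c * c' - d * d')
       (a * b' + b * a' + c * d' - d * c')
       (a * c' - b * d' + c * a' + d * b')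
       (a * d' + b * c' - c * b' + d * a').

Lemma quat_mulA : associative quat_mul.
Proof. by move=> [? ? ? ?] [? ? ? ?] [? ? ? ?]; congr Quat; ring. Qed.
Lemma quat_mul1q : left_id (qreal 1) quat_mul.
Proof. by move=> [? ? ? ?]; congr Quat; ring. Qed.
Lemma quat_mulq1 : right_id (qreal 1) quat_mul.
Proof. by move=> [? ? ? ?]; congr Quat; ring. Qed.
Lemma quat_mulDl : left_distributive quat_mul (@quat_add R).
Proof.
by move=> [? ? ? ?] [? ? ? ?] [? ? ? ?]; congr Quat; rewrite /=; ring.
Qed.
Lemma quat_mulDr : right_distributive quat_mul (@quat_add R).
Proof.
by move=> [? ? ? ?] [? ? ? ?] [? ? ? ?]; congr Quat; rewrite /=; ring.
Qed.
Lemma quat_one_neq0 : qreal 1 != 0 :> quaternion R.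
Proof. by apply/eqP => -[] /eqP; rewrite oner_eq0. Qed.

HB.instance Definition _ :=
  GRing.Zmodule_isNzRing.Build (quaternion R)
    quat_mulA quat_mul1q quat_mulq1 quat_mulDl quat_mulDr quat_one_neq0.

Definition ctrmx m n (A : 'M[quaternion R]_(m, n)) : 'M[quaternion R]_(n, m) :=
  (map_mx (@qconj R) A)^T.

(* The scalar x^* A x. *)
Definition qform n (A : 'M[quaternion R]_n) (x : 'cV[quaternion R]_n) :
    quaternion R :=
  (ctrmx x *m A *m x) 0 0.
End QuaternionRing.

Section NumericalRadius.
Variable R : realType.

Definition qmod (q : quaternion R) : R :=
  Num.sqrt (qre q ^+ 2 + qim1 q ^+ 2 + qim2 q ^+ 2 + qim3 q ^+ 2).

(* q >= 0 for a quaternion q means that q is real and nonnegative. *)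
Definition qnneg (q : quaternion R) : Prop := exists2 t : R, 0 <= t & q = qreal t.

Definition psdmx N (Z : 'M[quaternion R]_N) : Prop :=
  ctrmx Z = Z /\ forall x : 'cV[quaternion R]_N, qnneg (qform Z x).

Definition is_max (S : set R) (m : R) : Prop := S m /\ ubound S m.
Definition is_min (S : set R) (m : R) : Prop := S m /\ lbound S m.

(* The greatest element of S (unique by antisymmetry); 0 if there is none. *)
Definition max_of (S : set R) : R := xget 0 [set m | is_max S m].

Definition numradius n (A : 'M[quaternion R]_n) : R :=
  max_of [set qmod (qform A x) | x in
           [set x : 'cV[quaternion R]_n | (ctrmx x *m x) 0 0 = 1]].

Definition numradius_dual n (C : 'M[quaternion R]_n) : R :=
  max_of [set qre (\tr (ctrmx A *m C)) | A in
           [set A : 'M[quaternion R]_n | numradius A <= 1]].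
End NumericalRadius.

(* Main.v *)
Require Import Defs.
From HB Require Import structures.
From mathcomp Require Import all_boot all_order all_algebra.
From mathcomp Require Import spectral complex ring lra.
From mathcomp Require Import boolp classical_sets reals.
From mathcomp Require Import topology normedtype derive.
Set Implicit Arguments.
Unset Strict Implicit.
Unset Printing Implicit Defensive.
Import Order.TTheory GRing.Theory Num.Theory.
Import numFieldNormedType.Exports.
Local Open Scope ring_scope.
Local Open Scope classical_set_scope.

(** Call [W] feasible for [Y] when the block matrix with diagonal blocks [W],
    [W] and off-diagonal blocks [Y], [Y^*] is positive semidefinite.  The
    theorem is a strong duality: [Re Tr (A^* Y) <= Tr W] whenever [r(A) <= 1]
    and [W] is feasible for [Y], and both sides are attained with equality.

    Weak duality ([weak_duality]).  Over the complex numbers, factor the block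
    matrix as [G G^*] with [G] made of two halves [G1], [G2]; then
    [W = G1 G1^* = G2 G2^*] and [Y = G1 G2^*].  When [W] is invertible this
    forces [G1 = G2 V] with [V] unitary, and diagonalizing [V] yields
    [W = T T^*], [Y = T D T^*] with [D] diagonal and unimodular
    ([psd_block_diagonalization]).  Thus [Y] is a sum of matrices
    [d_i t_i t_i^*] with [|d_i| = 1], while [Tr W] is the sum of the
    [|t_i|^2]; so [Re Tr (B^* Y) <= sum_i |t_i^* B t_i| <= Tr W] as soon as
    [|t^* B t| <= |t|^2].  A singular [W] is a limit of invertible ones.  The
    quaternionic case follows from the complex one by writing a quaternionic
    matrix of size [n] as a complex matrix of size [2n]: the complex quadratic
    form is a component of the quaternionic one, so the hypothesis on the
    numerical radius is inherited, and traces are doubled.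

    Strong duality.  The feasible matrices of bounded trace form a compact
    set, so there is one, [W_Y], of least trace ([minimal_feasible]).  The
    function [Y |-> Tr W_Y] is sublinear because feasible pairs form a convex
    cone.  Hahn-Banach ([hahn_banach_rV]) gives a real-linear functional below
    it which touches it at [Y], and every such functional is
    [Z |-> Re Tr (A^* Z)] for some [A].  Testing it on the matrices
    [x u x^*] with [|x| = |u| = 1], for which [x x^*] is feasible
    ([feasible_rank1]), gives [Re (conj (x^* A x) u) <= 1] for every unit [u],
    that is [r(A) <= 1]. *)

(** * Weak duality for complex matrices *)

Section ComplexMatrices.
Local Open Scope sesquilinear_scope.
Variable C : numClosedFieldType.

Lemma conjtM m n p (A : 'M[C]_(m, n)) (B : 'M[C]_(n, p)) :
  (A *m B)^t* = B^t* *m A^t*.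
Proof. by rewrite trmx_mul map_mxM. Qed.

(** Rewriting with this turns diagonal entries of a congruence into values of
    the quadratic form at the columns. *)
Lemma conjt_form_entry m n p q (S : 'M[C]_(m, p)) (A : 'M[C]_(m, n))
    (T : 'M[C]_(n, q)) i j :
  (S^t* *m A *m T) i j = ((col i S)^t* *m A *m col j T) 0 0.
Proof.
rewrite !mxE; apply: eq_bigr => k _; rewrite !mxE; congr (_ * _).
by apply: eq_bigr => l _; rewrite !mxE.
Qed.

Lemma psd_factorization n (P : 'M[C]_n) :
  P^t* = P -> (forall x : 'cV[C]_n, 0 <= (x^t* *m P *m x) 0 0) ->
  exists G : 'M[C]_n, P = G *m G^t*.
Proof.
move=> Ph Ppos.
have Pn : P \is normalmx by apply/normalmxP; rewrite Ph.
have U := spectral_unitarymx P.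
move/orthomx_spectralP: Pn; rewrite (invmx_unitary U).
move: (spectralmx P) (spectral_diag P) U => Q d U Pe.
have Qt : Q *m Q^t* = 1%:M by apply/unitarymxP.
have De : diag_mx d = (Q^t*)^t* *m P *m Q^t*.
  by rewrite Pe trmxCK !mulmxA Qt mul1mx -mulmxA Qt mulmx1.
have d_ge0 i : 0 <= d 0 i.
  have := Ppos (col i (Q^t*)).
  by rewrite -conjt_form_entry -De mxE eqxx mulr1n.
exists (Q^t* *m diag_mx (map_mx sqrtC d)).
rewrite conjtM trmxCK mulmxA -(mulmxA (Q^t*)) {1}Pe; congr (_ *m _ *m _).
rewrite tr_diag_mx map_diag_mx mulmx_diag; congr diag_mx.
apply/rowP => i; rewrite !mxE.
have /conj_Creal e : sqrtC (d 0 i) \is Num.real by rewrite ger0_real ?sqrtC_ge0.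
by rewrite [X in _ * X]e -expr2 sqrtCK.
Qed.

Lemma unitary_completion m k (F : 'M[C]_(m, m + k)) : F \is unitarymx ->
  exists F' : 'M[C]_(k, m + k), col_mx F F' \is unitarymx.
Proof.
move=> FU.
pose O := orthomx Num.conj (mx_of_hermitian (hermitian1mx _)) F.
have rkO : \rank O = k.
  by rewrite rank_ortho (mxrank_unitary FU) addKn.
have [F' [F'U F'F]] : exists F' : 'M[C]_(k, m + k), F' \is unitarymx /\ F' *m F^t* = 0.
  have := schmidt_unitarymx (row_base O) (rank_leq_col _).
  have : (schmidt (row_base O) <= O)%MS.
    by rewrite (eqmx_schmidt_free (row_base_free O)) eq_row_base.
  move: (schmidt (row_base O)); rewrite rkO => F' F'O F'U; exists F'; split=> //.
  exact/orthomx1P.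
exists F'; apply/unitarymxP.
rewrite tr_col_mx map_row_mx mul_col_row (unitarymxP FU) (unitarymxP F'U) F'F.
have -> : F *m F'^t* = 0.
  by have := congr1 (fun M : 'M__ => M^t*) F'F; rewrite /= conjtM trmxCK trmx0 map_mx0.
by rewrite -scalar_mx_block.
Qed.

(** Complete both to square unitary matrices and take the quotient. *)
Lemma unitary_link m k (F1 F2 : 'M[C]_(m, m + k)) :
  F1 \is unitarymx -> F2 \is unitarymx ->
  exists2 V : 'M[C]_(m + k), V \is unitarymx & F1 = F2 *m V.
Proof.
move=> U1 U2.
have [F1' V1] := unitary_completion U1; have [F2' V2] := unitary_completion U2.
exists ((col_mx F2 F2')^t* *m col_mx F1 F1').
  by rewrite mul_unitarymx// trmxC_unitary.
rewrite -[X in X *m _](col_mxKu F2 F2') mul_usub_mx mulmxA (unitarymxP V2).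
by rewrite mul1mx col_mxKu.
Qed.

Lemma unitary_diagonalization k (V : 'M[C]_k) : V \is unitarymx ->
  exists2 Q : 'M[C]_k, Q \is unitarymx &
  exists2 d : 'rV[C]_k, forall i, `|d 0 i| = 1 & V = Q^t* *m diag_mx d *m Q.
Proof.
move=> VU; have Vn : V \is normalmx.
  apply/normalmxP; rewrite (unitarymxP VU).
  by rewrite -(invmx_unitary VU) mulVmx// unitarymx_unit.
have QU := spectral_unitarymx V.
move/orthomx_spectralP: Vn; rewrite (invmx_unitary QU).
move: (spectralmx V) (spectral_diag V) QU => Q d QU Ve.
exists Q => //; exists d => // i.
have De : diag_mx d = Q *m V *m Q^t*.
  by rewrite Ve !mulmxA (unitarymxP QU) mul1mx -mulmxA (unitarymxP QU) mulmx1.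
have : diag_mx d \is unitarymx by rewrite De !mul_unitarymx ?trmxC_unitary.
move=> /unitarymxP; rewrite tr_diag_mx map_diag_mx mulmx_diag => /matrixP/(_ i i).
rewrite !mxE eqxx !mulr1n => e.
by apply/eqP; rewrite -sqrp_eq1 // normCK; apply/eqP.
Qed.

(** With [W = S S^*], the two halves of a square root of the block matrix become,
    after multiplication by the inverse of [S], matrices with orthonormal rows.
    They therefore differ by a unitary factor, and [T] and [d] come from its
    spectral decomposition. *)
Lemma psd_block_diagonalization m (W Y : 'M[C]_m) :
  (block_mx W Y (Y^t*) W)^t* = block_mx W Y (Y^t*) W ->
  (forall x : 'cV_(m + m), 0 <= (x^t* *m block_mx W Y (Y^t*) W *m x) 0 0) ->
  W \in unitmx ->
  exists2 T : 'M[C]_(m, m + m), W = T *m T^t* &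
  exists2 d : 'rV[C]_(m + m), forall i, `|d 0 i| = 1 & Y = T *m diag_mx d *m T^t*.
Proof.
move=> Ph Ppos Wu.
have [G PG] := psd_factorization Ph Ppos.
have := PG; rewrite -[G]vsubmxK tr_col_mx map_row_mx mul_col_row.
case/eq_block_mx; set G1 := usubmx G; set G2 := dsubmx G => W1 Ye _ W2.
have [S WS] : exists S : 'M[C]_m, W = S *m S^t*.
  apply: psd_factorization => [|x].
    by move: Ph; rewrite tr_block_mx map_block_mx => /eq_block_mx[].
  have := Ppos (col_mx x 0).
  rewrite tr_col_mx map_row_mx mul_row_block trmx0 map_mx0 !mul0mx !addr0.
  by rewrite mul_row_col mulmx0 addr0.
have Su : S \in unitmx by move: Wu; rewrite WS unitmx_mul => /andP[].
have Stu : S^t* \in unitmx by move: Wu; rewrite WS unitmx_mul => /andP[].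
have FU (H : 'M[C]_(m, m + m)) : W = H *m H^t* -> invmx S *m H \is unitarymx.
  move=> WH; apply/unitarymxP; rewrite conjtM mulmxA -(mulmxA (invmx S)) -WH WS.
  rewrite mulmxA mulVmx // mul1mx trmx_inv map_invmx mulmxV //.
have [V VU F12] := unitary_link (FU _ W1) (FU _ W2).
have [Q QU [d d1 Vd]] := unitary_diagonalization VU.
have QtQ : Q^t* *m Q = 1%:M.
  by rewrite -(invmx_unitary QU) mulVmx// unitarymx_unit.
have SK (H : 'M[C]_(m, m + m)) : S *m (invmx S *m H) = H by rewrite mulKVmx.
exists (G2 *m Q^t*).
  by rewrite conjtM trmxCK mulmxA -(mulmxA G2) QtQ mulmx1.
exists d => //; rewrite conjtM trmxCK Ye.
by rewrite -(SK G1) F12 !mulmxA mulmxV // mul1mx Vd !mulmxA.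
Qed.

Lemma conjt_form_sum m n (A : 'M[C]_(m, n)) (x : 'cV_m) (y : 'cV_n) :
  (x^t* *m A *m y) 0 0 = \sum_i \sum_j (x i 0)^* * A i j * y j 0.
Proof.
rewrite exchange_big mxE; apply: eq_bigr => j _; rewrite mxE mulr_suml.
by apply: eq_bigr => i _; rewrite !mxE.
Qed.

Lemma conjt_mxtrace_dot m n (A B : 'M[C]_(m, n)) :
  \tr (A^t* *m B) = \sum_i \sum_j (A i j)^* * B i j.
Proof.
rewrite exchange_big /mxtrace; apply: eq_bigr => i _; rewrite mxE.
by apply: eq_bigr => k _; rewrite !mxE.
Qed.

Lemma complex_weak_duality_strict m (W Y B : 'M[C]_m) :
  (block_mx W Y (Y^t*) W)^t* = block_mx W Y (Y^t*) W ->
  (forall x : 'cV_(m + m), 0 <= (x^t* *m block_mx W Y (Y^t*) W *m x) 0 0) ->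
  W \in unitmx ->
  (forall x : 'cV[C]_m, `|(x^t* *m B *m x) 0 0| <= (x^t* *m x) 0 0) ->
  'Re (\tr (B^t* *m Y)) <= \tr W.
Proof.
move=> Ph Ppos Wu Bx.
have [T -> [d d1 ->]] := psd_block_diagonalization Ph Ppos Wu.
rewrite mulmxA mxtrace_mulC !mulmxA (mxtrace_mulC T).
have -> : T^t* *m B^t* *m T = (T^t* *m B *m T)^t* by rewrite !conjtM trmxCK mulmxA.
apply: le_trans (_ : \sum_i `|(T^t* *m B *m T) i i| <= _).
  rewrite /mxtrace raddf_sum; apply: ler_sum => i _.
  rewrite mul_mx_diag !mxE (le_trans (leif_Re_Creal _))// normrM d1 mulr1.
  by rewrite norm_conjC.
rewrite [leRHS]/mxtrace; apply: ler_sum => i _.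
rewrite -[T^t* in leRHS]mulmx1 !(conjt_form_entry T _ T) mulmx1.
exact: (Bx (col i T)).
Qed.

(** The invertible case is applied to [W + e], with [e] a positive scalar. *)
Lemma complex_weak_duality m (W Y B : 'M[C]_m) :
  (block_mx W Y (Y^t*) W)^t* = block_mx W Y (Y^t*) W ->
  (forall x : 'cV_(m + m), 0 <= (x^t* *m block_mx W Y (Y^t*) W *m x) 0 0) ->
  (forall x : 'cV[C]_m, `|(x^t* *m B *m x) 0 0| <= (x^t* *m x) 0 0) ->
  'Re (\tr (B^t* *m Y)) <= \tr W.
Proof.
move=> Ph Ppos Bx.
have Wh : W^t* = W by move: Ph; rewrite tr_block_mx map_block_mx => /eq_block_mx[].
have trW : \tr W \is Num.real.
  apply/CrealP; rewrite -[in RHS]Wh /mxtrace rmorph_sum.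
  by apply: eq_bigr => i _; rewrite !mxE.
have key e : 0 < e -> 'Re (\tr (B^t* *m Y)) <= \tr W + e *+ m.
  move=> e0; rewrite -(mxtrace_scalar m e) -mxtraceD.
  have eR : e^* = e by apply/CrealP; rewrite gtr0_real.
  have dE : block_mx (W + e%:M) Y (Y^t*) (W + e%:M) =
      block_mx W Y (Y^t*) W + e%:M.
    by rewrite scalar_mx_block add_block_mx !addr0.
  have eh k : (e%:M : 'M[C]_k)^t* = e%:M.
    by rewrite tr_scalar_mx map_scalar_mx /= eR.
  have dot_ge0 k (x : 'cV[C]_k) : 0 <= (x^t* *m x) 0 0.
    by rewrite mxE sumr_ge0 // => i _; rewrite !mxE mulrC mul_conjC_ge0.
  have ex k (x : 'cV[C]_k) : (x^t* *m e%:M *m x) 0 0 = e * (x^t* *m x) 0 0.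
    by rewrite mul_mx_scalar -scalemxAl mxE.
  apply: complex_weak_duality_strict => //.
  - by rewrite dE linearD map_mxD /= Ph eh.
  - move=> x; rewrite dE mulmxDr mulmxDl mxE addr_ge0 // ex.
    by rewrite mulr_ge0 // ltW.
  rewrite -row_free_unit -kermx_eq0; apply/rowV0P => v /sub_kermxP vW.
  have : (v *m (W + e%:M) *m v^t*) 0 0 = 0 by rewrite vW mul0mx mxE.
  rewrite -{1}(trmxCK v) mulmxDr mulmxDl [X in X = _ -> _]mxE ex.
  have W0 : 0 <= ((v^t*)^t* *m W *m v^t*) 0 0.
    have := Ppos (col_mx (v^t*) 0).
    rewrite tr_col_mx map_row_mx mul_row_block trmx0 map_mx0 !mul0mx !addr0.
    by rewrite mul_row_col mulmx0 addr0.
  have e0' := mulr_ge0 (ltW e0) (dot_ge0 _ (v^t*)).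
  move=> /eqP; rewrite paddr_eq0 // mulf_eq0 (gt_eqF e0) /= => /andP[_].
  rewrite mxE psumr_eq0 => [/allP v0|i _]; last first.
    by rewrite !mxE mulrC mul_conjC_ge0.
  apply/rowP => i; have := v0 i (mem_index_enum i).
  by rewrite !mxE conjCK mul_conjC_eq0 => /eqP.
rewrite real_leNgt ?Creal_Re //; apply/negP => lt.
(* With [e = (d - Tr W) / (m + 1)] the surplus [m e] stays below [d - Tr W]. *)
set d := 'Re _ in key lt.
have d0 : 0 < (d - \tr W) / m.+1%:R by rewrite divr_gt0 ?subr_gt0 ?ltr0n.
have := key _ d0; rewrite -lerBlDl -[leLHS](divfK (_ : m.+1%:R != 0)) ?pnatr_eq0//.
by rewrite mulr_natr ler_pMn2l ?ltnn.
Qed.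

End ComplexMatrices.

(** * Quaternionic matrices *)

Section QuaternionAlgebra.
Variable R : comNzRingType.
Implicit Types p q : quaternion R.

Lemma qre_is_additive : zmod_morphism (@qre R).
Proof. by case=> [????] [????]. Qed.
HB.instance Definition _ :=
  GRing.isZmodMorphism.Build (quaternion R) R (@qre R) qre_is_additive.

Lemma qconj_is_additive : zmod_morphism (@qconj R).
Proof. by case=> [????] [????]; congr Quat => /=; rewrite opprD opprK. Qed.
HB.instance Definition _ :=
  GRing.isZmodMorphism.Build (quaternion R) (quaternion R) (@qconj R)
    qconj_is_additive.

Lemma qreal_is_additive : zmod_morphism (@qreal R).
Proof. by move=> a b; congr Quat => /=; rewrite subrr. Qed.
HB.instance Definition _ :=
  GRing.isZmodMorphism.Build R (quaternion R) (@qreal R) qreal_is_additive.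

Lemma qconjK : involutive (@qconj R).
Proof. by case=> a b c d; congr Quat; rewrite /= opprK. Qed.

Lemma qconjM p q : qconj (p * q) = qconj q * qconj p.
Proof. by case: p q => [a b c d] [a' b' c' d']; congr Quat; rewrite /=; ring. Qed.

Lemma qconj_real (t : R) : qconj (qreal t) = qreal t.
Proof. by congr Quat => /=; rewrite oppr0. Qed.

Lemma qre_conj q : qre (qconj q) = qre q.
Proof. by []. Qed.

Lemma qreMC p q : qre (p * q) = qre (q * p).
Proof. by case: p q => [a b c d] [a' b' c' d'] /=; ring. Qed.

Lemma qreal_mulC (t : R) q : qreal t * q = q * qreal t.
Proof. by case: q => a b c d; congr Quat; rewrite /=; ring. Qed.

Lemma qre_realM (t : R) q : qre (qreal t * q) = t * qre q.
Proof. by case: q => a b c d /=; ring. Qed.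

Lemma qrealM (s t : R) : qreal (s * t) = qreal s * qreal t.
Proof. by congr Quat; rewrite /=; ring. Qed.

Definition qnorm2 q : R := qre q ^+ 2 + qim1 q ^+ 2 + qim2 q ^+ 2 + qim3 q ^+ 2.

Lemma qnorm2M p q : qnorm2 (p * q) = qnorm2 p * qnorm2 q.
Proof. by case: p q => [a b c d] [a' b' c' d']; rewrite /qnorm2 /=; ring. Qed.

Lemma qnorm2_real t : qnorm2 (qreal t) = t ^+ 2.
Proof. by rewrite /qnorm2 /=; ring. Qed.

Lemma qnorm2_conj q : qnorm2 (qconj q) = qnorm2 q.
Proof. by case: q => a b c d; rewrite /qnorm2 /=; ring. Qed.

Lemma qmul_conj q : qconj q * q = qreal (qnorm2 q).
Proof. by case: q => a b c d; congr Quat; rewrite /qnorm2 /=; ring. Qed.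

Lemma qnorm2D p q : qnorm2 (p + q) = qnorm2 p + qnorm2 q + qre (qconj p * q) *+ 2.
Proof. by case: p q => [a b c d] [a' b' c' d']; rewrite /qnorm2 /=; ring. Qed.

Lemma qre_sum I (r : seq I) (P : pred I) (F : I -> quaternion R) :
  qre (\sum_(i <- r | P i) F i) = \sum_(i <- r | P i) qre (F i).
Proof. exact: raddf_sum. Qed.

Lemma qconj_sum I (r : seq I) (P : pred I) (F : I -> quaternion R) :
  qconj (\sum_(i <- r | P i) F i) = \sum_(i <- r | P i) qconj (F i).
Proof. exact: raddf_sum. Qed.

Lemma qconjN q : qconj (- q) = - qconj q.
Proof. exact: raddfN. Qed.

Lemma qreN q : qre (- q) = - qre q.
Proof. exact: raddfN. Qed.

Lemma ctrmxE m n (A : 'M[quaternion R]_(m, n)) i j : ctrmx A i j = qconj (A j i).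
Proof. by rewrite !mxE. Qed.

Lemma ctrmxK m n (A : 'M[quaternion R]_(m, n)) : ctrmx (ctrmx A) = A.
Proof. by apply/matrixP => i j; rewrite !ctrmxE qconjK. Qed.

Lemma ctrmxD m n (A B : 'M[quaternion R]_(m, n)) :
  ctrmx (A + B) = ctrmx A + ctrmx B.
Proof. by apply/matrixP => i j; rewrite ctrmxE !mxE raddfD. Qed.

Lemma ctrmxM m n k (A : 'M[quaternion R]_(m, n)) (B : 'M[quaternion R]_(n, k)) :
  ctrmx (A *m B) = ctrmx B *m ctrmx A.
Proof.
apply/matrixP => i j; rewrite ctrmxE !mxE raddf_sum.
by apply: eq_bigr => l _; rewrite !ctrmxE -qconjM.
Qed.

Lemma ctrmxZ m n t (A : 'M[quaternion R]_(m, n)) :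
  ctrmx (qreal t *: A) = qreal t *: ctrmx A.
Proof. by apply/matrixP => i j; rewrite !(ctrmxE, mxE) qconjM qconj_real qreal_mulC. Qed.

Lemma ctrmx_scalar n t : ctrmx ((qreal t)%:M : 'M[quaternion R]_n) = (qreal t)%:M.
Proof.
by apply/matrixP => i j; rewrite ctrmxE !mxE raddfMn /= qconj_real eq_sym.
Qed.

Lemma ctrmx_block m1 m2 n1 n2 (A : 'M[quaternion R]_(m1, n1)) (B : 'M_(m1, n2))
    (C : 'M_(m2, n1)) (D : 'M_(m2, n2)) :
  ctrmx (block_mx A B C D) = block_mx (ctrmx A) (ctrmx C) (ctrmx B) (ctrmx D).
Proof. by rewrite /ctrmx map_block_mx tr_block_mx. Qed.

Lemma ctrmx_col m1 m2 n (A : 'M[quaternion R]_(m1, n)) (B : 'M_(m2, n)) :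
  ctrmx (col_mx A B) = row_mx (ctrmx A) (ctrmx B).
Proof. by rewrite /ctrmx map_col_mx tr_col_mx. Qed.

(** Scaling only commutes with left factors for central scalars. *)
Lemma mulmx_realZr m n k t (A : 'M[quaternion R]_(m, n)) (B : 'M_(n, k)) :
  A *m (qreal t *: B) = qreal t *: (A *m B).
Proof.
apply/matrixP => i j; rewrite !mxE mulr_sumr; apply: eq_bigr => l _.
by rewrite !mxE !mulrA -qreal_mulC.
Qed.

(** The real part suffices for positivity: the form of a selfadjoint matrix is
    real on the diagonal. *)
Definition hform n (A : 'M[quaternion R]_n) (x y : 'cV[quaternion R]_n) : R :=
  qre ((ctrmx x *m A *m y) 0 0).

Lemma qre_entryD m n (A B : 'M[quaternion R]_(m, n)) i j :
  qre ((A + B) i j) = qre (A i j) + qre (B i j).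
Proof. by rewrite mxE. Qed.

Lemma mxform_sum m n (A : 'M[quaternion R]_(m, n)) (x : 'cV_m) (y : 'cV_n) :
  (ctrmx x *m A *m y) 0 0 = \sum_i \sum_j qconj (x i 0) * A i j * y j 0
  :> quaternion R.
Proof.
rewrite exchange_big mxE; apply: eq_bigr => j _; rewrite mxE mulr_suml.
by apply: eq_bigr => i _; rewrite ctrmxE.
Qed.

Lemma hformDl n (A B : 'M[quaternion R]_n) x y :
  hform (A + B) x y = hform A x y + hform B x y.
Proof. by rewrite /hform mulmxDr mulmxDl mxE raddfD. Qed.

Lemma hformZl n t (A : 'M[quaternion R]_n) x y :
  hform (qreal t *: A) x y = t * hform A x y.
Proof. by rewrite /hform mulmx_realZr -scalemxAl mxE qre_realM. Qed.

Lemma hform_ctrmx n (A : 'M[quaternion R]_n) x y :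
  hform (ctrmx A) x y = hform A y x.
Proof.
by rewrite /hform -[RHS]qre_conj -[in RHS]ctrmxE !ctrmxM !ctrmxK mulmxA.
Qed.

(** The standard real inner product: the sum of the products of the real
    coordinates of the entries. *)
Definition mxdot m n (A B : 'M[quaternion R]_(m, n)) : R := qre (\tr (ctrmx A *m B)).

Lemma mxdot_sum m n (A B : 'M[quaternion R]_(m, n)) :
  mxdot A B = \sum_i \sum_j qre (qconj (A i j) * B i j).
Proof.
rewrite exchange_big /mxdot /mxtrace raddf_sum; apply: eq_bigr => j _.
by rewrite mxE raddf_sum; apply: eq_bigr => i _; rewrite ctrmxE.
Qed.

End QuaternionAlgebra.

(** * Feasible pairs *)

Section Feasible.
Variable R : realType.
Implicit Types (p q : quaternion R).

Lemma qnorm2_ge0 q : 0 <= qnorm2 q.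
Proof. by rewrite !addr_ge0 ?sqr_ge0. Qed.

Definition vnorm2 n (x : 'cV[quaternion R]_n) : R := \sum_i qnorm2 (x i 0).

Lemma vnorm2_ge0 n (x : 'cV_n) : 0 <= vnorm2 x.
Proof. by apply: sumr_ge0 => i _; apply: qnorm2_ge0. Qed.

Lemma ctrmx_mul_self n (x : 'cV[quaternion R]_n) :
  (ctrmx x *m x) 0 0 = qreal (vnorm2 x).
Proof.
rewrite mxE raddf_sum; apply: eq_bigr => i _.
by rewrite ctrmxE qmul_conj.
Qed.

Lemma hform1 n (x : 'cV[quaternion R]_n) : hform 1%:M x x = vnorm2 x.
Proof. by rewrite /hform mulmx1 ctrmx_mul_self. Qed.

Lemma qform_hermitian n (Z : 'M[quaternion R]_n) x :
  ctrmx Z = Z -> qform Z x = qreal (hform Z x x).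
Proof.
move=> Zh; have : qconj (qform Z x) = qform Z x.
  by rewrite /qform -ctrmxE !ctrmxM ctrmxK Zh mulmxA.
rewrite /hform -/(qform Z x); case: (qform Z x) => a b c d [] /= hb hc hd.
by congr Quat; lra.
Qed.

(** Positivity of the block matrix, read on pairs of vectors.  Each condition is a
    real-linear equation or inequality in [(Y, W)], so feasible pairs form a closed
    convex cone. *)
Definition feasible n (Y W : 'M[quaternion R]_n) :=
  ctrmx W = W /\ forall x y, 0 <= hform W x x + hform W y y + hform Y x y *+ 2.

Lemma feasibleP n (W Y : 'M[quaternion R]_n) :
  psdmx (block_mx W Y (ctrmx Y) W) <-> feasible Y W.
Proof.
have E x y : hform (block_mx W Y (ctrmx Y) W) (col_mx x y) (col_mx x y)
    = hform W x x + hform W y y + hform Y x y *+ 2.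
  rewrite /hform ctrmx_col mul_row_block mul_row_col !mulmxDl.
  rewrite !qre_entryD -!/(hform _ _ _) hform_ctrmx; ring.
split=> [[Zh Zpos]|[Wh pos]].
  have Wh : ctrmx W = W by move: Zh; rewrite ctrmx_block => /eq_block_mx[].
  split=> // x y; rewrite -E.
  by have [t t0] := Zpos (col_mx x y); rewrite qform_hermitian // => -[->].
have Zh : ctrmx (block_mx W Y (ctrmx Y) W) = block_mx W Y (ctrmx Y) W.
  by rewrite ctrmx_block Wh ctrmxK.
split=> // x; exists (hform (block_mx W Y (ctrmx Y) W) x x).
  by rewrite -[x]vsubmxK E.
exact: qform_hermitian.
Qed.

Lemma feasibleD n (Y1 Y2 W1 W2 : 'M[quaternion R]_n) :
  feasible Y1 W1 -> feasible Y2 W2 -> feasible (Y1 + Y2) (W1 + W2).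
Proof.
move=> [h1 p1] [h2 p2]; split=> [|x y]; first by rewrite ctrmxD h1 h2.
by rewrite !hformDl; have := p1 x y; have := p2 x y; lra.
Qed.

Lemma feasibleZ n t (Y W : 'M[quaternion R]_n) : 0 <= t ->
  feasible Y W -> feasible (qreal t *: Y) (qreal t *: W).
Proof.
move=> t0 [h p]; split=> [|x y]; first by rewrite ctrmxZ h.
by rewrite !hformZl -mulrnAr -!mulrDr mulr_ge0.
Qed.

Lemma hform_psd n (Y W : 'M[quaternion R]_n) x : feasible Y W -> 0 <= hform W x x.
Proof.
move=> [_ /(_ x 0)]; rewrite /hform !mulmx0 !mxE; lra.
Qed.

(** A large multiple of the identity is feasible: each term [x_i^* Y_ij y_j] is
    controlled by [|x_i|^2 + |Y_ij|^2 |y_j|^2]. *)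
Lemma feasible_exists n (Y : 'M[quaternion R]_n) : exists W, feasible Y W.
Proof.
pose S := \sum_i \sum_j qnorm2 (Y i j).
have S0 : 0 <= S by do 2![apply: sumr_ge0 => ? _]; apply: qnorm2_ge0.
exists (qreal (S + n%:R) *: 1%:M); split=> [|x y].
  by rewrite ctrmxZ -[1%:M]/((qreal 1)%:M) ctrmx_scalar.
have x0 := vnorm2_ge0 x; have y0 := vnorm2_ge0 y.
rewrite !hformZl !hform1.
suff : - (n%:R * vnorm2 x + S * vnorm2 y) <= hform Y x y *+ 2.
  have := mulr_ge0 S0 x0; have := mulr_ge0 (ler0n R n) y0.
  by rewrite !mulrDl; lra.
rewrite /hform mxform_sum qre_sum -sumrMnl.
have -> : n%:R * vnorm2 x + S * vnorm2 y =
    \sum_i \sum_j (qnorm2 (x i 0) + qnorm2 (Y i j) * vnorm2 y).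
  rewrite mulr_sumr mulr_suml -big_split; apply: eq_bigr => i _.
  by rewrite [RHS]big_split /= sumr_const card_ord mulr_natl mulr_suml.
rewrite -sumrN; apply: ler_sum => i _.
rewrite qre_sum -sumrMnl -sumrN; apply: ler_sum => j _.
have := qnorm2_ge0 (x i 0 + Y i j * y j 0); rewrite qnorm2D qnorm2M mulrA.
have : qnorm2 (Y i j) * qnorm2 (y j 0) <= qnorm2 (Y i j) * vnorm2 y.
  apply: ler_wpM2l; first exact: qnorm2_ge0.
  by rewrite /vnorm2 (bigD1 j) //= lerDl sumr_ge0 // => *; apply: qnorm2_ge0.
lra.
Qed.

(** The block form at [(y, z)] is [|a|^2 + |b|^2 + 2 Re (conj a u b)] with
    [a = x^* y] and [b = x^* z], that is [|a + u b|^2]. *)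
Lemma feasible_rank1 n (x : 'cV[quaternion R]_n) (u : quaternion R) :
  qnorm2 u = 1 -> feasible (x *m (u *: ctrmx x)) (x *m ctrmx x).
Proof.
move=> u1; split=> [|y z]; first by rewrite ctrmxM ctrmxK.
pose a := (ctrmx x *m y) 0 0; pose b := (ctrmx x *m z) 0 0.
have E v : hform (x *m ctrmx x) v v = qnorm2 ((ctrmx x *m v) 0 0).
  rewrite /hform mulmxA -mulmxA mxE big_ord1 -{1}[x]ctrmxK -ctrmxM ctrmxE.
  by rewrite qmul_conj.
have -> : hform (x *m (u *: ctrmx x)) y z = qre (qconj a * (u * b)).
  rewrite /hform mulmxA -mulmxA mxE big_ord1 -{1}[x]ctrmxK -ctrmxM ctrmxE.
  by rewrite -scalemxAl [X in _ * X]mxE.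
rewrite !E -/a -/b -[qnorm2 b]mul1r -u1 -qnorm2M -qnorm2D.
exact: qnorm2_ge0.
Qed.

Lemma mxdot_rank1 n (A : 'M[quaternion R]_n) x (u : quaternion R) :
  mxdot A (x *m (u *: ctrmx x)) = qre (qconj (qform A x) * u).
Proof.
rewrite mxdot_sum /qform mxform_sum qconj_sum mulr_suml qre_sum.
apply: eq_bigr => i _.
rewrite qconj_sum mulr_suml qre_sum; apply: eq_bigr => j _.
rewrite mxE big_ord1 mxE ctrmxE !qconjM qconjK.
by rewrite 2!mulrA [LHS]qreMC !mulrA.
Qed.

Lemma trace_psd n (Y W : 'M[quaternion R]_n) : feasible Y W ->
  \tr W = qreal (qre (\tr W)).
Proof.
move=> [h _]; have : qconj (\tr W) = \tr W.
  rewrite -[in RHS]h /mxtrace raddf_sum; apply: eq_bigr => i _.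
  by rewrite ctrmxE.
case: (\tr W) => a b c d [] /= hb hc hd; congr Quat; lra.
Qed.

Lemma hform_delta n (A : 'M[quaternion R]_n) i j a b :
  hform A (a *: delta_mx i 0) (b *: delta_mx j 0) = qre (qconj a * A i j * b).
Proof.
have E c k l : (c *: delta_mx k 0 : 'cV[quaternion R]_n) l 0 = if l == k then c else 0.
  by rewrite !mxE eqxx andbT; case: eqP; rewrite ?mulr1 ?mulr0.
rewrite /hform mxform_sum; congr qre.
rewrite (bigD1 i) //= (bigD1 j) //= !E !eqxx.
rewrite [X in _ + X + _]big1 => [|k kj]; last by rewrite !E (negPf kj) mulr0.
rewrite big1 ?addr0 // => k ki.
by apply: big1 => l _; rewrite E (negPf ki) raddf0 !mul0r.
Qed.

Lemma hformDD n (A : 'M[quaternion R]_n) x y z w :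
  hform A (x + y) (z + w) = hform A x z + hform A x w + hform A y z + hform A y w.
Proof.
by rewrite /hform ctrmxD !mulmxDl !mulmxDr !qre_entryD -!/(hform _ _ _); ring.
Qed.

(** Positivity of [W] at [e_i - e_j u] gives
    [2 Re (W_ij u) <= W_ii + W_jj <= 2 Tr W].  This bounds each real coordinate of
    each entry of [W]. *)
Lemma feasible_entry n (Y W : 'M[quaternion R]_n) i j u :
  feasible Y W -> qnorm2 u = 1 -> qre (W i j * u) <= qre (\tr W).
Proof.
move=> F u1; have [h _] := F.
have diag k : 0 <= qre (W k k).
  have := hform_psd (1 *: delta_mx k 0) F.
  by rewrite hform_delta mulr1 qconj_real mul1r.
have diag_le k : qre (W k k) <= qre (\tr W).
  rewrite /mxtrace raddf_sum (bigD1 k) //= lerDl sumr_ge0 //.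
have := hform_psd (1 *: delta_mx i 0 + (- u) *: delta_mx j 0) F.
rewrite hformDD !hform_delta.
have -> : W j i = qconj (W i j) by rewrite -ctrmxE h.
have -> : qre (qconj (- u) * W j j * - u) = qre (W j j).
  rewrite qreMC mulrA qconjN mulrNN -{1}[u]qconjK qmul_conj.
  by rewrite qnorm2_conj u1 qre_realM mul1r.
rewrite qconj_real mul1r mulr1 mulrN qconjN !mulNr !qreN mul1r.
have -> : qre (qconj u * qconj (W i j) * qreal 1) = qre (W i j * u).
  by rewrite mulr1 -qconjM.
have := diag_le i; have := diag_le j; lra.
Qed.
End Feasible.

(** * Weak duality for quaternionic matrices *)

Section Embedding.
Variable R : realType.
Local Open Scope sesquilinear_scope.
Local Notation C := R[i].

(** A quaternion is [z + w j] with [z], [w] complex. *)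
Definition qfst (q : quaternion R) : C := Complex (qre q) (qim1 q).
Definition qsnd (q : quaternion R) : C := Complex (qim2 q) (qim3 q).

(** Left multiplication by [A], read on the complex coordinates [(u, v)] of a
    quaternionic vector [u + j v]. *)
Definition cmx n (A : 'M[quaternion R]_n) : 'M[C]_(n + n) :=
  block_mx (map_mx qfst A) (- map_mx qsnd A)
    (map_mx (conjc \o qsnd) A) (map_mx (conjc \o qfst) A).

(** The vector [u + j v]; since [j i = - k], the [k]-coordinate is the opposite of
    the imaginary part of [v]. *)
Definition qvec n (x : 'cV[C]_(n + n)) : 'cV[quaternion R]_n :=
  \col_i let u := usubmx x i 0 in let v := dsubmx x i 0 in
    Quat (complex.Re u) (complex.Im u) (complex.Re v) (- complex.Im v).

Lemma qfst_is_additive : zmod_morphism qfst.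
Proof. by case=> [????] [????]. Qed.
HB.instance Definition _ :=
  GRing.isZmodMorphism.Build (quaternion R) C qfst qfst_is_additive.

(** The complex form is only the [C]-component of the quaternionic one, so it is
    smaller in modulus, and equal to it when the latter is real. *)
Lemma qfst_form n (A : 'M[quaternion R]_n) x y :
  qfst ((ctrmx (qvec x) *m A *m qvec y) 0 0) = (x^t* *m cmx A *m y) 0 0.
Proof.
rewrite mxform_sum conjt_form_sum [RHS]big_split_ord /= -big_split raddf_sum /=.
apply: eq_bigr => i _; rewrite !big_split_ord /= -!big_split raddf_sum /=.
apply: eq_bigr => j _; rewrite block_mxEul block_mxEur block_mxEdl block_mxEdr.
rewrite !mxE.
case: (A i j) (x (lshift n i) 0) (x (rshift n i) 0)
  (y (lshift n j) 0) (y (rshift n j) 0) => [a b c d] [x1 x2] [x3 x4] [y1 y2] [y3 y4].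
by congr Complex; rewrite /=; ring.
Qed.

Lemma cmx_ctrmx n (A : 'M[quaternion R]_n) : cmx (ctrmx A) = (cmx A)^t*.
Proof.
rewrite /cmx tr_block_mx map_block_mx; congr block_mx; apply/matrixP => i j;
  rewrite !mxE; case: (A j i) => a b c d; congr Complex; rewrite /= ?opprK //.
Qed.

Lemma cmx_dot n (A B : 'M[quaternion R]_n) :
  'Re (\tr ((cmx A)^t* *m cmx B)) = Complex (mxdot A B *+ 2) 0.
Proof.
have -> : \tr ((cmx A)^t* *m cmx B) = Complex (mxdot A B *+ 2) 0.
  rewrite conjt_mxtrace_dot mxdot_sum [LHS]big_split_ord /= -big_split /=.
  pose F i j := Complex (qre (qconj (A i j) * B i j) *+ 2) 0 : C.
  transitivity (\sum_i \sum_j F i j).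
    apply: eq_bigr => i _; rewrite !big_split_ord /= -!big_split /=.
    apply: eq_bigr => j _.
    rewrite !(block_mxEul, block_mxEur, block_mxEdl, block_mxEdr) !mxE /F.
    case: (A i j) (B i j) => [a b c d] [a' b' c' d'].
    by congr Complex; rewrite /=; ring.
  rewrite -sumrMnl -[RHS]/(real_complex R _) raddf_sum.
  by apply: eq_bigr => i _; rewrite -sumrMnl raddf_sum.
by apply/Creal_ReP; rewrite -[_ \in _]/(_ \is Num.real) complex_real.
Qed.

Lemma cmx_trace n (A : 'M[quaternion R]_n) :
  \tr (cmx A) = Complex (qre (\tr A) *+ 2) 0.
Proof.
rewrite mxtrace_block /mxtrace -big_split qre_sum.
rewrite -sumrMnl -[RHS]/(real_complex R _) raddf_sum; apply: eq_bigr => i _.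
rewrite !mxE; case: (A i i) => a b c d; congr Complex; rewrite /=; ring.
Qed.

Lemma qvec_norm n (x : 'cV[C]_(n + n)) :
  (x^t* *m x) 0 0 = Complex (vnorm2 (qvec x)) 0.
Proof.
rewrite mxE big_split_ord /= -big_split /vnorm2 -[RHS]/(real_complex R _) raddf_sum /=.
apply: eq_bigr => i _; rewrite !mxE.
case: (x (lshift n i) 0) (x (rshift n i) 0) => [x1 x2] [x3 x4].
by congr Complex; rewrite /qnorm2 /=; ring.
Qed.

Lemma weak_duality n (A Y W : 'M[quaternion R]_n) :
  feasible Y W -> (forall x, qnorm2 (qform A x) <= vnorm2 x ^+ 2) ->
  mxdot A Y <= qre (\tr W).
Proof.
move=> F Ax; have [Wh Wpos] := F.
have : 'Re (\tr ((cmx A)^t* *m cmx Y)) <= \tr (cmx W).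
  apply: complex_weak_duality => [|x|x].
  - by rewrite tr_block_mx map_block_mx trmxCK -cmx_ctrmx Wh.
  - rewrite -[x]vsubmxK; move: (usubmx x) (dsubmx x) => {x} x y.
    rewrite tr_col_mx map_row_mx mul_row_block mul_row_col !mulmxDl.
    have D (M N : 'M[C]_1) : (M + N) 0 0 = M 0 0 + N 0 0 by rewrite mxE.
    rewrite !D -cmx_ctrmx -!qfst_form -!raddfD /=.
    set X := qvec x; set Z := qvec y.
    have -> : (ctrmx X *m W *m X) 0 0 = qform W X by [].
    have -> : (ctrmx Z *m W *m Z) 0 0 = qform W Z by [].
    have -> : (ctrmx Z *m ctrmx Y *m X) 0 0 = qconj ((ctrmx X *m Y *m Z) 0 0).
      by rewrite -ctrmxE !ctrmxM ctrmxK mulmxA.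
    rewrite !qform_hermitian //; have := Wpos X Z; rewrite [hform Y X Z]/hform.
    case: ((ctrmx X *m Y *m Z) 0 0) => a b c d /= H.
    rewrite lecE /=; apply/andP; split; [apply/eqP|]; lra.
  - rewrite -qfst_form qvec_norm normc_def lecR.
    rewrite -(ger0_norm (vnorm2_ge0 _)) -sqrtr_sqr ler_wsqrtr // (le_trans _ (Ax _)) //.
    rewrite -/(qform A (qvec x)); case: (qform _ _) => a b c d; rewrite /qnorm2 /=.
    by rewrite -addrA lerDl addr_ge0 ?sqr_ge0.
rewrite cmx_dot cmx_trace lecE /= => /andP[_]; lra.
Qed.

End Embedding.

(** * Compactness *)

Section Coordinates.
Variables (R : realType) (m n : nat).

(** One summand for each of the four real coordinates of an entry.  With
    this shape a sum over the coordinates splits into four sums over the entries. *)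
Definition coord_index : Type :=
  ('I_m * 'I_n + 'I_m * 'I_n + ('I_m * 'I_n + 'I_m * 'I_n))%type.
HB.instance Definition _ := Finite.on coord_index.

Definition rdim := #|{: coord_index}|.

Definition mx_of_coord (w : 'rV[R]_rdim) : 'M[quaternion R]_(m, n) :=
  let c (k : coord_index) := w 0 (enum_rank k) in
  \matrix_(i, j) Quat (c (inl (inl (i, j)))) (c (inl (inr (i, j))))
                      (c (inr (inl (i, j)))) (c (inr (inr (i, j)))).

Lemma mx_of_coord_surj (A : 'M[quaternion R]_(m, n)) : exists w, mx_of_coord w = A.
Proof.
exists (\row_k match enum_val k : coord_index with
  | inl (inl (i, j)) => qre (A i j) | inl (inr (i, j)) => qim1 (A i j)
  | inr (inl (i, j)) => qim2 (A i j) | inr (inr (i, j)) => qim3 (A i j) end).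
by apply/matrixP => i j; rewrite !mxE !enum_rankK; case: (A i j).
Qed.

Lemma mx_of_coordD v w : mx_of_coord (v + w) = mx_of_coord v + mx_of_coord w.
Proof. by apply/matrixP => i j; rewrite !mxE. Qed.

Lemma mx_of_coordZ t w : mx_of_coord (t *: w) = qreal t *: mx_of_coord w.
Proof. by apply/matrixP => i j; rewrite !mxE; congr Quat; ring. Qed.

Lemma mxdot_mx_of_coord v w :
  mxdot (mx_of_coord v) (mx_of_coord w) = \sum_k v 0 k * w 0 k.
Proof.
rewrite mxdot_sum pair_bigA /= [RHS](reindex (@enum_rank coord_index)) /=; last first.
  exact/onW_bij/enum_rank_bij.
rewrite !big_sumType /= -!big_split /=; apply: eq_bigr => -[i j] _.
by rewrite !mxE /=; ring.
Qed.

End Coordinates.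

Section QuaternionContinuity.
Variables (R : realType) (T : topologicalType).
Implicit Types f g : T -> quaternion R.

(** Coordinatewise, which avoids putting a topology on the quaternions. *)
Definition qcontinuous f :=
  [/\ continuous (@qre R \o f), continuous (@qim1 R \o f),
      continuous (@qim2 R \o f) & continuous (@qim3 R \o f)].

Lemma qcontinuous_cst q : qcontinuous (fun=> q).
Proof. by split=> x; apply: cvg_cst. Qed.

Lemma qcontinuousD f g : qcontinuous f -> qcontinuous g ->
  qcontinuous (fun t => f t + g t).
Proof.
case=> f0 f1 f2 f3 [g0 g1 g2 g3]; split=> x; [exact: (continuousD (f0 x) (g0 x)) |
  exact: (continuousD (f1 x) (g1 x)) | exact: (continuousD (f2 x) (g2 x)) |
  exact: (continuousD (f3 x) (g3 x))].
Qed.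

Lemma qcontinuous_conj f : qcontinuous f -> qcontinuous (fun t => qconj (f t)).
Proof.
case=> f0 f1 f2 f3; split=> // x;
  [exact: (continuousN (f1 x)) | exact: (continuousN (f2 x)) |
   exact: (continuousN (f3 x))].
Qed.

Lemma qcontinuousM f g : qcontinuous f -> qcontinuous g ->
  qcontinuous (fun t => f t * g t).
Proof.
case=> f0 f1 f2 f3 [g0 g1 g2 g3].
have E t : f t * g t = Quat
  (qre (f t) * qre (g t) - qim1 (f t) * qim1 (g t) - qim2 (f t) * qim2 (g t) - qim3 (f t) * qim3 (g t))
  (qre (f t) * qim1 (g t) + qim1 (f t) * qre (g t) + qim2 (f t) * qim3 (g t) - qim3 (f t) * qim2 (g t))
  (qre (f t) * qim2 (g t) - qim1 (f t) * qim3 (g t) + qim2 (f t) * qre (g t) + qim3 (f t) * qim1 (g t))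
  (qre (f t) * qim3 (g t) + qim1 (f t) * qim2 (g t) - qim2 (f t) * qim1 (g t) + qim3 (f t) * qre (g t)).
  by case: (f t) (g t) => [? ? ? ?] [? ? ? ?].
have -> : (fun t => f t * g t) = _ := funext E.
have M (a b : T -> R) : continuous a -> continuous b -> continuous (fun t => a t * b t).
  by move=> ac bc x; exact: (continuousM (ac x) (bc x)).
have D (a b : T -> R) : continuous a -> continuous b -> continuous (fun t => a t + b t).
  by move=> ac bc x; exact: (continuousD (ac x) (bc x)).
have B (a b : T -> R) : continuous a -> continuous b -> continuous (fun t => a t - b t).
  by move=> ac bc x; exact: (continuousB (ac x) (bc x)).
split.
- exact: B _ _ (B _ _ (B _ _ (M _ _ f0 g0) (M _ _ f1 g1)) (M _ _ f2 g2)) (M _ _ f3 g3).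
- exact: B _ _ (D _ _ (D _ _ (M _ _ f0 g1) (M _ _ f1 g0)) (M _ _ f2 g3)) (M _ _ f3 g2).
- exact: D _ _ (D _ _ (B _ _ (M _ _ f0 g2) (M _ _ f1 g3)) (M _ _ f2 g0)) (M _ _ f3 g1).
- exact: D _ _ (B _ _ (D _ _ (M _ _ f0 g3) (M _ _ f1 g2)) (M _ _ f2 g1)) (M _ _ f3 g0).
Qed.

Lemma qcontinuous_sum I (r : seq I) (P : pred I) (F : I -> T -> quaternion R) :
  (forall i, qcontinuous (F i)) -> qcontinuous (fun t => \sum_(i <- r | P i) F i t).
Proof.
move=> Fc; elim: r => [|i r IH].
  by under [X in qcontinuous X]eq_fun do rewrite big_nil; apply: qcontinuous_cst.
under [X in qcontinuous X]eq_fun do rewrite big_cons.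
by case: (P i) => //; apply: qcontinuousD.
Qed.

Lemma qcontinuous_norm2 f : qcontinuous f -> continuous (fun t => qnorm2 (f t)).
Proof.
move=> fc; have [c _ _ _] := qcontinuousM (qcontinuous_conj fc) fc.
suff -> : (fun t => qnorm2 (f t)) = @qre R \o (fun t => qconj (f t) * f t) by [].
by apply: funext => t; rewrite /comp qmul_conj.
Qed.

Lemma closed_qeq f g : qcontinuous f -> qcontinuous g ->
  closed [set t | f t = g t].
Proof.
move=> fc gc.
have -> : [set t | f t = g t] =
    (fun t => qnorm2 (f t + - 1 * g t)) @^-1` [set x | x = 0].
  apply/seteqP; split=> t /=; first by move=> ->; rewrite mulN1r subrr /qnorm2 /=; ring.
  rewrite mulN1r => /eqP; rewrite !paddr_eq0 ?addr_ge0 ?sqr_ge0 // !sqrf_eq0 => e.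
  apply/eqP; rewrite -subr_eq0; move: e; case: (_ - _) => a b c d /=.
  by move=> /andP[/andP[/andP[/eqP-> /eqP->] /eqP->] /eqP->].
apply: preimage_closed; last exact: closed_eq.
move=> x _; apply: qcontinuous_norm2; apply: qcontinuousD => //.
by apply: qcontinuousM => //; apply: qcontinuous_cst.
Qed.

Lemma qcontinuous_form m n (x : T -> 'cV[quaternion R]_m)
    (A : T -> 'M[quaternion R]_(m, n)) (y : T -> 'cV[quaternion R]_n) :
  (forall i, qcontinuous (fun t => x t i 0)) ->
  (forall i j, qcontinuous (fun t => A t i j)) ->
  (forall i, qcontinuous (fun t => y t i 0)) ->
  qcontinuous (fun t => (ctrmx (x t) *m A t *m y t) 0 0).
Proof.
move=> xc Ac yc; under [X in qcontinuous X]eq_fun do rewrite mxform_sum.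
apply: qcontinuous_sum => i; apply: qcontinuous_sum => j.
by do 2![apply: qcontinuousM => //]; apply: qcontinuous_conj.
Qed.
End QuaternionContinuity.

Lemma qcontinuous_mx_of_coord (R : realType) m n i j :
  qcontinuous (fun w : 'rV[R]_(rdim m n) => mx_of_coord w i j).
Proof.
by split=> w; rewrite /comp; under [X in continuous_at _ X]eq_fun do rewrite mxE;
  apply: coord_continuous.
Qed.

Lemma box_EVT_min (R : realType) d (f : 'rV[R]_d -> R) (A : set 'rV[R]_d) M :
  A !=set0 -> closed A -> (forall v, A v -> forall i, `|v 0 i| <= M) ->
  continuous f -> exists2 c, A c & forall v, A v -> f c <= f v.
Proof.
move=> A0 Acl AM fc.
have Ac : compact A.
  have box : compact [set v : 'rV[R]_d | forall i, `[- M, M]%classic (v ord0 i)].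
    by apply: (@rV_compact _ _ (fun=> `[- M, M]%classic)) => _; apply: segment_compact.
  apply: subclosed_compact Acl box _ => v Av i.
  by rewrite /= in_itv /= -ler_norml AM.
have [|c cA cmin] := @EVT_min_rV R d f A A0 Ac.
  exact: continuous_subspaceT.
by exists c => [|v vA]; [move: cA; rewrite inE|apply: cmin; rewrite inE].
Qed.

(** * The Hahn-Banach theorem in finite dimension *)

Section HahnBanach.
Variables (R : realType) (V : lmodType R).
Implicit Types (p q : V -> R) (x y e : V).

Definition sublinear p :=
  (forall x y, p (x + y) <= p x + p y) /\
  (forall (t : R) x, 0 <= t -> p (t *: x) <= t * p x).

Lemma sublinear_opp p x : sublinear p -> - p (- x) <= p x.
Proof.
move=> [pD pZ]; have := pD x (- x); rewrite subrr.
have := pD 0 0; rewrite addr0; lra.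
Qed.

Lemma sublinear0 p : sublinear p -> p 0 = 0.
Proof.
move=> [pD pZ]; have := pD 0 0; have := pZ 0 0 (lexx 0).
rewrite addr0 scale0r; lra.
Qed.

Lemma sublinearZ p (t : R) x : sublinear p -> 0 <= t -> p (t *: x) = t * p x.
Proof.
move=> ps; rewrite le_eqVlt => /predU1P[<-|t0].
  by rewrite scale0r mul0r sublinear0.
have [_ pZ] := ps; apply/eqP; rewrite eq_le (pZ _ _ (ltW t0)) /=.
have := pZ t^-1 (t *: x); rewrite scalerA mulVf ?gt_eqF // scale1r invr_ge0.
by move=> /(_ (ltW t0)); rewrite ler_pdivlMl.
Qed.

(** Replacing [p x] by the infimum over [t >= 0] of [p (x + t e) - t p e] makes
    the functional linear along the line of [e] and keeps it sublinear. *)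
Lemma sublinear_tighten p e : sublinear p ->
  exists q, [/\ sublinear q, forall x, q x <= p x & q (- e) <= - p e].
Proof.
move=> ps; have [pD pZ] := ps.
pose S x := [set p (x + t *: e) - t * p e | t in [set t | 0 <= t]].
have Slb x : has_lbound (S x).
  exists (- p (- x)) => _ [t /= t0 <-].
  have := pD (x + t *: e) (- x); rewrite addrAC subrr add0r sublinearZ //; lra.
have S0 x : S x !=set0 by exists (p (x + 0 *: e) - 0 * p e); exists 0 => /=.
have inf_le x t : 0 <= t -> inf (S x) <= p (x + t *: e) - t * p e.
  by move=> t0; apply: ge_inf => //; exists t.
have le_infS x b : (forall t, 0 <= t -> b <= p (x + t *: e) - t * p e) -> b <= inf (S x).
  by move=> H; apply: lb_le_inf => // _ [t /= t0 <-]; apply: H.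
exists (fun x => inf (S x)); split.
- split=> [x y|s x s0].
    rewrite -lerBlDr; apply: (le_infS _ _) => t t0; rewrite lerBlDr -lerBlDl.
    apply: (le_infS _ _) => u u0; rewrite lerBlDl.
    apply: le_trans (inf_le _ (t + u) (addr_ge0 t0 u0)) _.
    have := pD (x + t *: e) (y + u *: e); rewrite addrACA -scalerDl; lra.
  move: s0; rewrite le_eqVlt => /predU1P[<-|s0].
    by apply: le_trans (inf_le _ 0 (lexx 0)) _; rewrite !scale0r addr0 sublinear0 // !mul0r subr0.
  rewrite -ler_pdivrMl //; apply: (le_infS _ _) => t t0; rewrite ler_pdivrMl //.
  apply: le_trans (inf_le _ (s * t) _) _; first by rewrite mulr_ge0 // ltW.
  by rewrite -scalerA -scalerDr mulrBr mulrA lerD2r pZ // ltW.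
- by move=> x; apply: le_trans (inf_le x 0 (lexx 0)) _; rewrite scale0r addr0 mul0r subr0.
- apply: le_trans (inf_le _ 1 ler01) _.
  by rewrite scale1r addNr mul1r sublinear0 // sub0r.
Qed.

(** Linearity along a line survives any further decrease, so the tightenings can
    be done in succession. *)
Lemma sublinear_tighten_seq (s : seq V) p : sublinear p ->
  exists q, [/\ sublinear q, forall x, q x <= p x &
    forall e, e \in s -> q (- e) <= - q e].
Proof.
elim: s p => [|e s IH] p ps; first by exists p.
have [p1 [p1s p1p p1e]] := sublinear_tighten e ps.
have [q [qs qp1 qlin]] := IH _ p1s.
exists q; split=> // [x|e'].
  exact: le_trans (qp1 x) (p1p x).
rewrite in_cons => /predU1P[->|/qlin//].
have := qp1 (- e); have := qp1 e; have := p1p e; lra.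
Qed.

End HahnBanach.

(** A sublinear functional that is linear along each coordinate axis is linear.
    Tightening along [y] first fixes the value at [y]. *)
Lemma hahn_banach_rV (R : realType) d (p : 'rV[R]_d -> R) (y : 'rV[R]_d) :
  sublinear p -> exists c : 'rV[R]_d,
    (forall x : 'rV_d, \sum_k c 0 k * x 0 k <= p x) /\ p y <= \sum_k c 0 k * y 0 k.
Proof.
move=> ps; have [p1 [p1s p1p p1y]] := sublinear_tighten y ps.
have [q [qs qp1 qlin]] :=
  sublinear_tighten_seq [seq delta_mx 0 k | k <- enum 'I_d] p1s.
pose f (x : 'rV[R]_d) := \sum_k q (delta_mx 0 k) * x 0 k.
have qf x : q x <= f x.
  rewrite {1}[x]row_sum_delta /f; elim/big_ind2 : _ => [|a b a' b' H H'|k _].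
  - by rewrite sublinear0.
  - by apply: le_trans (qs.1 _ _) _; apply: lerD.
  - have [x0|x0] := leP 0 (x 0 k); first by rewrite sublinearZ // mulrC.
    have x0' : 0 <= - x 0 k by rewrite oppr_ge0 ltW.
    have -> : x 0 k *: delta_mx 0 k = (- x 0 k) *: (- delta_mx 0 k) :> 'rV[R]_d.
      by rewrite scaleNr scalerN opprK.
    rewrite sublinearZ //.
    have : q (- delta_mx 0 k) <= - q (delta_mx 0 k).
      by apply: qlin; apply: map_f; rewrite mem_enum.
    move=> /(ler_wpM2l x0'); lra.
have fN x : f (- x) = - f x.
  by rewrite /f -sumrN; apply: eq_bigr => k _; rewrite mxE mulrN.
exists (\row_k q (delta_mx 0 k)).
have E (x : 'rV_d) : \sum_k (\row_k q (delta_mx 0 k)) 0 k * x 0 k = f x.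
  by apply: eq_bigr => k _; rewrite mxE.
split=> [x|]; rewrite E.
  have := qf (- x); rewrite fN; have := sublinear_opp x qs.
  have := sublinear_opp (- x) qs; rewrite opprK.
  have := qp1 x; have := p1p x; lra.
have := qf y; have := sublinear_opp y qs; have := qp1 (- y); lra.
Qed.

(** * A feasible matrix of least trace *)

Section Attainment.
Variable R : realType.

Lemma minimal_feasible n (Y : 'M[quaternion R]_n) : exists W, feasible Y W /\
  forall W', feasible Y W' -> qre (\tr W) <= qre (\tr W').
Proof.
have [W1 F1] := feasible_exists Y; set t := qre (\tr W1).
pose W (w : 'rV[R]_(rdim n n)) : 'M[quaternion R]_n := mx_of_coord w.
have Wc i j : qcontinuous (fun w => W w i j) by apply: qcontinuous_mx_of_coord.
have hc (x y : 'cV[quaternion R]_n) : continuous (fun w => hform (W w) x y).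
  by have [] := qcontinuous_form (fun i => qcontinuous_cst _ (x i 0)) Wc
    (fun i => qcontinuous_cst _ (y i 0)).
have tc : continuous (fun w => qre (\tr (W w))).
  by have [] := qcontinuous_sum (index_enum 'I_n) predT (fun i => Wc i i).
pose A := [set w | feasible Y (W w) /\ qre (\tr (W w)) <= t].
have [w1 w1E] := mx_of_coord_surj W1.
have A0 : A !=set0 by exists w1; split; rewrite /W w1E.
have Acl : closed A.
  have -> : A = [set w | qre (\tr (W w)) <= t] `&`
     (\bigcap_(ij in [set: 'I_n * 'I_n]) [set w | qconj (W w ij.2 ij.1) = W w ij.1 ij.2]) `&`
     (\bigcap_(xy in [set: 'cV[quaternion R]_n * 'cV[quaternion R]_n])
        [set w | 0 <= hform (W w) xy.1 xy.1 + hform (W w) xy.2 xy.2 + hform Y xy.1 xy.2 *+ 2]).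
    apply/seteqP; split=> w.
      move=> [[Wh Wp] Wt]; split; first split=> //.
      - by move=> [i j] _ /=; rewrite -ctrmxE Wh.
      - by move=> [x y] _ /=.
    move=> [[Wt Wh] Wp]; split=> //; split=> [|x y]; last exact: (Wp (x, y)).
    by apply/matrixP => i j; rewrite ctrmxE (Wh (i, j)).
  apply: closedI; first apply: closedI.
  - by apply: (preimage_closed (f := fun w => qre (\tr (W w))) _ (@closed_le _ t)) => w _; apply: tc.
  - apply: closed_bigI => -[i j] _; apply: closed_qeq => //.
    exact: qcontinuous_conj.
  apply: closed_bigI => -[x y] _ /=.
  apply: (preimage_closed (f := fun w => hform (W w) x x + hform (W w) y y + hform Y x y *+ 2)
    _ (@closed_ge _ 0)) => w _.
  have cc : {for w, continuous (fun _ : 'rV[R]_(rdim n n) => hform Y x y *+ 2)}.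
    exact: cst_continuous.
  exact: (continuousD (continuousD (hc x x w) (hc y y w)) cc).
have Abd v : A v -> forall k, `|v 0 k| <= t.
  move=> [Fv tv] k.
  have B u i j : qnorm2 u = 1 -> qre (W v i j * u) <= t.
    by move=> u1; apply: le_trans (feasible_entry i j Fv u1) tv.
  have B' u i j : qnorm2 u = 1 -> `|qre (W v i j * u)| <= t.
    move=> u1; rewrite ler_norml B // andbT lerNl -qreN -mulrN B //.
    by move: u1; case: u => a b c d; rewrite /qnorm2 /= !sqrrN.
  rewrite -[k](@enum_valK (coord_index n n)).
  (* Multiplying by 1, -i, -j, -k moves each coordinate to the real part. *)
  have u1 : qnorm2 (Quat 1 0 0 0 : quaternion R) = 1 by rewrite /qnorm2 /=; ring.
  have u2 : qnorm2 (Quat 0 (-1) 0 0 : quaternion R) = 1 by rewrite /qnorm2 /=; ring.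
  have u3 : qnorm2 (Quat 0 0 (-1) 0 : quaternion R) = 1 by rewrite /qnorm2 /=; ring.
  have u4 : qnorm2 (Quat 0 0 0 (-1) : quaternion R) = 1 by rewrite /qnorm2 /=; ring.
  case: (enum_val k) => [[[i j]|[i j]]|[[i j]|[i j]]].
  - by have := B' _ i j u1; rewrite mxE /=; congr (`|_| <= _); ring.
  - by have := B' _ i j u2; rewrite mxE /=; congr (`|_| <= _); ring.
  - by have := B' _ i j u3; rewrite mxE /=; congr (`|_| <= _); ring.
  - by have := B' _ i j u4; rewrite mxE /=; congr (`|_| <= _); ring.
have [w [Fw wt] wmin] := box_EVT_min A0 Acl Abd tc.
exists (W w); split=> // W' FW'.
have [le|/ltW lt] := leP (qre (\tr W')) t; last exact: le_trans wt lt.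
have [w' w'E] := mx_of_coord_surj W'.
by have := wmin w'; rewrite /A /W /= w'E; apply.
Qed.

(** * The numerical radius *)

Lemma is_max_unique (S : set R) a b : is_max S a -> is_max S b -> a = b.
Proof. by move=> [Sa ua] [Sb ub]; apply/eqP; rewrite eq_le ua // ub. Qed.

Lemma max_ofE (S : set R) a : is_max S a -> max_of S = a.
Proof.
move=> Sa; apply: is_max_unique (Sa).
exact: (xgetPex 0 (ex_intro (is_max S) a Sa)).
Qed.

(** The unit sphere is compact and nonempty, so the numerical radius is a genuine
    maximum and not the default value of [max_of]. *)
Lemma numradius_is_max n (A : 'M[quaternion R]_n) : (0 < n)%N ->
  is_max [set qmod (qform A x) | x in
           [set x : 'cV[quaternion R]_n | (ctrmx x *m x) 0 0 = 1]] (numradius A).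
Proof.
move=> n0.
pose X (w : 'rV[R]_(rdim n 1)) : 'cV[quaternion R]_n := mx_of_coord w.
have Xc i : qcontinuous (fun w => X w i 0) by apply: qcontinuous_mx_of_coord.
have fc : continuous (fun w => - qnorm2 (qform A (X w)) : R).
  have qc : qcontinuous (fun w => qform A (X w)).
    by apply: qcontinuous_form => // i j; apply: qcontinuous_cst.
  by move=> w; exact: (continuousN (@qcontinuous_norm2 _ _ _ qc w)).
pose S := [set w | (ctrmx (X w) *m X w) 0 0 = 1].
have [w0 w0E] := mx_of_coord_surj (delta_mx (Ordinal n0) 0 : 'cV[quaternion R]_n).
have S0 : S !=set0.
  exists w0; rewrite /S /= /X w0E mxE (bigD1 (Ordinal n0)) //= big1 ?addr0.
    by rewrite ctrmxE !mxE !eqxx /= qconj_real mulr1.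
  by move=> i /negPf ni; rewrite [X in _ * X]mxE ni mulr0.
have Scl : closed S.
  apply: closed_qeq; last exact: qcontinuous_cst.
  under [X in qcontinuous X]eq_fun do rewrite -[ctrmx _]mulmx1.
  by apply: qcontinuous_form => // i j; apply: qcontinuous_cst.
have Sbd v : S v -> forall k, `|v 0 k| <= 1.
  move=> Sv k; have : \sum_k v 0 k * v 0 k = 1.
    by rewrite -mxdot_mx_of_coord /mxdot trace_mx11 Sv.
  rewrite (bigD1 k) //= -expr2 => e.
  rewrite -(@ler_pXn2r _ 2) ?nnegrE // expr1n real_normK ?num_real // -e lerDl.
  by rewrite sumr_ge0 // => i _; rewrite -expr2 sqr_ge0.
have [w Sw wmin] := box_EVT_min S0 Scl Sbd fc.
suff H : is_max [set qmod (qform A x) | x in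
     [set x : 'cV[quaternion R]_n | (ctrmx x *m x) 0 0 = 1]] (qmod (qform A (X w))).
  by rewrite /numradius (max_ofE H).
split; first by exists (X w).
move=> _ [x x1 <-]; have [v vx] := mx_of_coord_surj x.
have := wmin v; rewrite /S /X /= vx lerN2 => /(_ x1) H.
by rewrite /qmod ler_wsqrtr.
Qed.

(** The form is homogeneous of degree two, so the bound on the unit sphere extends
    to all vectors. *)
Lemma numradius_le1 n (A : 'M[quaternion R]_n) x :
  numradius A <= 1 -> qnorm2 (qform A x) <= vnorm2 x ^+ 2.
Proof.
case: n => [|n] in A x *.
  by rewrite /qform mxform_sum big_ord0 /qnorm2 /= => _; rewrite /vnorm2 big_ord0; lra.
have [_ ub] := numradius_is_max A (ltn0Sn n) => A1.
have [x0|x0] := eqVneq (vnorm2 x) 0.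
  have -> : x = 0.
    apply/colP => i; move: x0 => /eqP; rewrite psumr_eq0 => [/allP/(_ i (mem_index_enum i))|j _].
      rewrite mxE /qnorm2 /= !paddr_eq0 ?addr_ge0 ?sqr_ge0 // !sqrf_eq0.
      by case: (x i 0) => a b c d /= /andP[/andP[/andP[/eqP-> /eqP->] /eqP->] /eqP->].
    exact: qnorm2_ge0.
  by rewrite /qform mulmx0 mxE -[0]/(qreal 0) qnorm2_real expr0n /= sqr_ge0.
have xp : 0 < vnorm2 x by rewrite lt_def x0 vnorm2_ge0.
pose s := (Num.sqrt (vnorm2 x))^-1.
have s2 : s ^+ 2 * vnorm2 x = 1 by rewrite exprVn (sqr_sqrtr (ltW xp)) mulVf.
have sx : (ctrmx (qreal s *: x) *m (qreal s *: x)) 0 0 = 1.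
  rewrite ctrmxZ mulmx_realZr -scalemxAl scalerA -qrealM mxE ctrmx_mul_self.
  by rewrite -qrealM -expr2 s2.
have : qmod (qform A (qreal s *: x)) <= 1.
  by apply: le_trans A1; apply: ub; exists (qreal s *: x).
have -> : qform A (qreal s *: x) = qreal (s ^+ 2) * qform A x.
  by rewrite /qform ctrmxZ mulmx_realZr -!scalemxAl scalerA -qrealM -expr2 mxE.
rewrite /qmod -/(qnorm2 _) -[X in _ <= X -> _]sqrtr1 ler_sqrt // qnorm2M qnorm2_real => H.
have : vnorm2 x ^+ 2 * (s ^+ 2 ^+ 2 * qnorm2 (qform A x)) <= vnorm2 x ^+ 2 * 1.
  by rewrite ler_wpM2l ?sqr_ge0.
by rewrite mulrA -exprMn [vnorm2 x * _]mulrC s2 expr1n mul1r mulr1.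
Qed.

(** Taking [u = h / |h|] with [h = x^* A x] makes [conj h u] equal to [|h|]. *)
Lemma numradius_le1_of n (A : 'M[quaternion R]_n) : (0 < n)%N ->
  (forall x u, vnorm2 x = 1 -> qnorm2 u = 1 -> qre (qconj (qform A x) * u) <= 1) ->
  numradius A <= 1.
Proof.
move=> n0 H; have [[x x1 <-] _] := numradius_is_max A n0.
have {}x1 : vnorm2 x = 1 by move: x1; rewrite /= ctrmx_mul_self => -[].
set h := qform A x; rewrite /qmod -/(qnorm2 h).
have [h0|h0] := eqVneq (qnorm2 h) 0; first by rewrite h0 sqrtr0 ler01.
have hp : 0 < qnorm2 h by rewrite lt_def h0 qnorm2_ge0.
pose s := (Num.sqrt (qnorm2 h))^-1.
have := H x (qreal s * h) x1; rewrite qnorm2M qnorm2_real exprVn (sqr_sqrtr (ltW hp)).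
rewrite mulVf // => /(_ erefl).
rewrite -/h qreal_mulC mulrA qmul_conj -qrealM /=.
by rewrite /s -{1}(sqr_sqrtr (ltW hp)) expr2 mulfK // gt_eqF // sqrtr_gt0.
Qed.

End Attainment.

(** * Strong duality *)

Theorem corollary5p3 (R : realType) (n : nat) (n_gt0 : (0 < n)%N)
    (Y : 'M[quaternion R]_n) :
  is_min
    [set t : R | exists W : 'M[quaternion R]_n,
       psdmx (block_mx W Y (ctrmx Y) W) /\ \tr W = qreal t]
    (numradius_dual Y).
Proof.
have [w wmin] := choice (@minimal_feasible R n).
pose val Z := qre (\tr (w Z)).
have val_le Z W : feasible Z W -> val Z <= qre (\tr W).
  by move=> F; have [_] := wmin Z; apply.
pose p (c : 'rV[R]_(rdim n n)) := val (mx_of_coord c).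
have ps : sublinear p.
  split=> [x y|t x t0]; rewrite /p.
    rewrite mx_of_coordD; have [Fx _] := wmin (mx_of_coord x).
    have [Fy _] := wmin (mx_of_coord y).
    by have := val_le _ _ (feasibleD Fx Fy); rewrite mxtraceD.
  rewrite mx_of_coordZ; have [Fx _] := wmin (mx_of_coord x).
  by have := val_le _ _ (feasibleZ t0 Fx); rewrite mxtraceZ qre_realM.
have [y yE] := mx_of_coord_surj Y.
have [c [cp cy]] := hahn_banach_rV y ps.
pose A := mx_of_coord c : 'M[quaternion R]_n.
have Adot Z : mxdot A Z <= val Z.
  by have [z <-] := mx_of_coord_surj Z; rewrite mxdot_mx_of_coord cp.
have [FY _] := wmin Y.
have A1 : numradius A <= 1.
  apply: numradius_le1_of => // x u x1 u1.
  rewrite -mxdot_rank1 (le_trans (Adot _)) //.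
  rewrite (le_trans (val_le _ _ (feasible_rank1 x u1))) //.
  rewrite -x1 /vnorm2 /mxtrace qre_sum; apply: ler_sum => i _.
  by rewrite mxE big_ord1 ctrmxE qreMC qmul_conj.
have weak B : numradius B <= 1 -> forall W, feasible Y W -> mxdot B Y <= qre (\tr W).
  by move=> B1 W F; apply: weak_duality F _ => x; apply: numradius_le1.
have AY : mxdot A Y = val Y.
  apply/eqP; rewrite eq_le Adot /=.
  by move: cy; rewrite -mxdot_mx_of_coord /p yE.
have -> : numradius_dual Y = val Y.
  apply: max_ofE; split; first by exists A.
  by move=> _ [B B1 <-]; apply: weak.
split.
  by exists (w Y); split; [exact/feasibleP | exact: (trace_psd FY)].
by move=> t [W [/feasibleP F tW]]; have := val_le _ _ F; rewrite tW.
Qed.
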